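(* Consider a reversible Markov decision problem (RMDP), with transition probability matrices $(P(u) : u \in \mathcal{U})$ on $\mathcal{X}$ and reward function $r : \mathcal{X}\times\mathcal{U} \to \mathbb{R}$, whose canonical graph $G=(\mathcal{X},\mathcal{E})$ is biconnected. Let $P^{(0)} = [p^{(0)}_{ij}]$ be an irreducible reversible transition probability matrix on $\mathcal{X}$ with $p^{(0)}_{ij}>0$ if and only if $(i,j)\in\mathcal{E}$, and let $\rho : \mathcal{X}\times\mathcal{U} \to (0,1]$ be such that for each $u\in\mathcal{U}$ we have $p_{ij}(u) = \rho(i,u)p^{(0)}_{ij}$ for $j \neq i$ and $p_{ii}(u) = 1-\rho(i,u)$. Consider any sequence $(\bar\mu^{(k)} \in \bar{\mathcal{M}}, k \ge 0)$ of stationary deterministic Markov strategies, starting from some $\bar\mu^{(0)} \in \bar{\mathcal{M}}$, where $\bar\mu^{(k+1)}$ is obtained from $\bar\mu^{(k)}$ by picking some state $i \in \mathcal{X}$ (if possible; otherwise the iteration stops) for which $$\frac{r(i,\bar\mu^{(k)}(i)) - \beta(\bar\mu^{(k)})}{\rho(i,\bar\mu^{(k)}(i))} < \max_{v \in \mathcal{U}} \frac{r(i,v) - \beta(\bar\mu^{(k)})}{\rho(i,v)}$$ and replacing $\bar\mu^{(k)}(i)$ by some action achieving the maximum on the right-hand side (leaving the actions at all other states unchanged). Then any such sequence has the property that $\beta(\bar\mu^{(k+1)}) > \beta(\bar\mu^{(k)})$ at each step, and the iteration terminates in a finite number of steps at a stationary deterministic optimal strategy.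
   Context: $\mathcal{X}$ (states) and $\mathcal{U}$ (actions) are finite sets, each of cardinality at least $2$. For each $u \in \mathcal{U}$, $P(u) = [p_{ij}(u)]$ is a transition probability matrix (row-stochastic matrix) on $\mathcal{X}$, and $r : \mathcal{X} \times \mathcal{U} \to \mathbb{R}$ is a reward function. A stationary randomized Markov strategy $\mu$ is a choice, for each $i \in \mathcal{X}$, of a probability distribution $(\mu(u|i) : u \in \mathcal{U})$ on $\mathcal{U}$; $\mathcal{M}$ is the set of all such strategies. For $\mu \in \mathcal{M}$, $P(\mu) = [p_{ij}(\mu)]$ with $p_{ij}(\mu) := \sum_u p_{ij}(u)\mu(u|i)$. $\bar{\mathcal{M}}$ is the set of stationary deterministic Markov strategies, i.e. functions $\bar\mu : \mathcal{X}\to\mathcal{U}$, regarded as elements of $\mathcal{M}$ via $\bar\mu(u|i) = 1$ if $u=\bar\mu(i)$ and $0$ otherwise. An irreducible transition probability matrix $P=[p_{ij}]$ with stationary distribution $(\pi_i)$ is reversible if $\pi_i p_{ij} = \pi_j p_{ji}$ for all $i,j$. The data form a reversible Markov decision problem (RMDP) if $P(\mu)$ is irreducible and reversible for every $\mu \in \mathcal{M}$. For $\mu\in\mathcal{M}$, $\pi(\mu) = (\pi_i(\mu))$ is the stationary distribution of $P(\mu)$ and $\beta(\mu)$ is the long-term average reward, $\beta(\mu) = \sum_i \pi_i(\mu) r(i,\mu)$ with $r(i,\mu) := \sum_u r(i,u)\mu(u|i)$. A strategy is optimal if it maximizes $\beta$ over $\mathcal{M}$. The canonical graph of an RMDP is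 the simple connected undirected graph $G = (\mathcal{X},\mathcal{E})$ (no multiple edges, no self-loops, so $(i,i)\notin\mathcal{E}$) such that for all $u \in \mathcal{U}$ and all distinct $i,j \in \mathcal{X}$, $p_{ij}(u) > 0$ if and only if $(i,j) \in \mathcal{E}$ (such a graph exists for every RMDP and is clearly unique). A graph is biconnected if whenever any single vertex, together with all the edges involving that vertex, is removed, the resulting graph continues to be connected. (For an RMDP with biconnected canonical graph, $P^{(0)}$ and $\rho$ as in the claim always exist.) *)

(* Defs.v *)
From HB Require Import structures.
From mathcomp Require Import all_boot all_order all_algebra.
From mathcomp Require Import boolp classical_sets reals.

Set Implicit Arguments.
Unset Strict Implicit.
Unset Printing Implicit Defensive.

Import Order.TTheory GRing.Theory Num.Theory.
Local Open Scope ring_scope.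

Definition is_distribution (R : realType) (T : finType) (p : T -> R) : Prop :=
  (forall t, 0 <= p t) /\ \sum_t p t = 1.

Definition is_transition_matrix (R : realType) (X : finType)
    (P : X -> X -> R) : Prop :=
  forall i, is_distribution (P i).

Definition irreducible (R : realType) (X : finType) (P : X -> X -> R) : Prop :=
  forall i j, connect [rel x y | 0 < P x y] i j.

Definition is_stationary (R : realType) (X : finType) (P : X -> X -> R)
    (pi : {ffun X -> R}) : Prop :=
  is_distribution pi /\ forall j, \sum_i pi i * P i j = pi j.

(* A stationary distribution of [P] selected by classical choice; it is the
   unique one when [P] is an irreducible transition matrix. The default [0] is
   returned only when [P] has no stationary distribution. *)
Definition stationary (R : realType) (X : finType) (P : X -> X -> R) :
    {ffun X -> R} :=
  xget 0 (is_stationary P).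

Definition reversible (R : realType) (X : finType) (P : X -> X -> R) : Prop :=
  exists2 pi, is_stationary P pi & forall i j, pi i * P i j = pi j * P j i.

(* [mu i u] is the probability mu(u|i). *)
Definition is_strategy (R : realType) (X U : finType) (mu : X -> U -> R) :
    Prop :=
  forall i, is_distribution (mu i).

Definition mixP (R : realType) (X U : finType) (P : U -> X -> X -> R)
    (mu : X -> U -> R) (i j : X) : R :=
  \sum_u P u i j * mu i u.

Definition mixr (R : realType) (X U : finType) (r : X -> U -> R)
    (mu : X -> U -> R) (i : X) : R :=
  \sum_u r i u * mu i u.

Definition det (R : realType) (X U : finType) (d : {ffun X -> U}) :
    X -> U -> R :=
  fun i u => (u == d i)%:R.

Definition is_rmdp (R : realType) (X U : finType) (P : U -> X -> X -> R) :
    Prop :=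
  (forall u, is_transition_matrix (P u)) /\
  (forall mu, is_strategy mu ->
     irreducible (mixP P mu) /\ reversible (mixP P mu)).

Definition beta (R : realType) (X U : finType) (P : U -> X -> X -> R)
    (r : X -> U -> R) (mu : X -> U -> R) : R :=
  \sum_i stationary (mixP P mu) i * mixr r mu i.

Definition optimal (R : realType) (X U : finType) (P : U -> X -> X -> R)
    (r : X -> U -> R) (mu : X -> U -> R) : Prop :=
  is_strategy mu /\ forall nu, is_strategy nu -> beta P r nu <= beta P r mu.

(* Connectedness of the subgraph of [E] induced on the vertex set [A]. *)
Definition connected_on (X : finType) (E : rel X) (A : {set X}) : Prop :=
  forall i j, i \in A -> j \in A ->
    connect [rel x y | [&& x \in A, y \in A & E x y]] i j.

Definition is_canonical_graph (R : realType) (X U : finType)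
    (P : U -> X -> X -> R) (E : rel X) : Prop :=
  [/\ symmetric E, irreflexive E, connected_on E [set: X]%SET
    & forall u i j, i != j -> (0 < P u i j <-> E i j)].

Definition biconnected (X : finType) (E : rel X) : Prop :=
  forall v, connected_on E [set~ v]%SET.

Definition improvement_ratio (R : realType) (X U : finType)
    (r rho : X -> U -> R) (b : R) (i : X) (v : U) : R :=
  (r i v - b) / rho i v.

(* [improvement_step P r rho d d'] : [d'] may follow [d] in the iteration. The
   starting value of the iterated maximum is one of the values maximized over,
   so [m] is the maximum over all actions [v]. *)
Definition improvement_step (R : realType) (X U : finType)
    (P : U -> X -> X -> R) (r rho : X -> U -> R) (d d' : {ffun X -> U}) : Prop :=
  exists i : X,
    let q := improvement_ratio r rho (beta P r (det R d)) i in
    let m := \big[Num.max/q (d i)]_(v : U) q v in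
    q (d i) < m /\
    exists2 v : U, q v = m & d' = [ffun j => if j == i then v else d j].

(* A maximal run of the iteration: [s k = Some d] when the [k]-th strategy
   exists and equals [d], and [s k = None] when the iteration has stopped
   before step [k]; it stops only when no improvement step is possible. *)
Definition is_policy_iteration (R : realType) (X U : finType)
    (P : U -> X -> X -> R) (r rho : X -> U -> R)
    (s : nat -> option {ffun X -> U}) : Prop :=
  s 0%N <> None /\
  forall k,
    match s k, s k.+1 with
    | Some d, Some d' => improvement_step P r rho d d'
    | Some d, None => ~ exists d', improvement_step P r rho d d'
    | None, Some _ => False
    | None, None => True
    end.

(* Main.v *)
Require Import Defs.
From HB Require Import structures.
From mathcomp Require Import all_boot all_order all_algebra.
From mathcomp Require Import boolp classical_sets reals.

Set Implicit Arguments.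
Unset Strict Implicit.
Unset Printing Implicit Defensive.

Import Order.TTheory GRing.Theory Num.Theory.
Local Open Scope ring_scope.

(** All the chains [mixP P mu] are slowed-down versions of the single chain
[P0]: at state [i] the chain moves according to [P0] with probability equal to
the speed [mixr rho mu i], and otherwise stays put. Slowing a chain down at [i]
only multiplies the time spent at [i] by the inverse of the speed, so the
stationary distribution of [mixP P mu] is proportional to
[pi0 i / mixr rho mu i], where [pi0] is stationary for [P0]. Hence
([beta_excess]), for every real [b], [beta P r mu - b] is a positive multiple of
[\sum_i pi0 i * ((mixr r mu i - b) / mixr rho mu i)].

In this sum the strategy enters through one separate term for each state, with
a positive weight [pi0 i] that does not depend on the strategy, and for a
deterministic strategy the [i]-th term is the improvement ratio. With
[b = beta P r (det R d)] the sum vanishes at [d]. An improvement step raises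
exactly one term, so the sum for the new strategy is positive and [beta] has
increased ([improvement_step_lt]). If no step is possible, then [d] maximizes
every term among actions; a randomized strategy replaces the [i]-th term by a
weighted mean of improvement ratios, with weights proportional to
[rho i u * mu i u], so it cannot do better either ([no_improvement_optimal]).
Termination follows because [beta] cannot increase for ever on a finite set. *)

(** * Irreducible and reversible chains *)

Lemma irreducible_closed (R : realType) (X : finType) (P : X -> X -> R)
    (A : pred X) :
  irreducible P -> (forall i j, A i -> 0 < P i j -> A j) ->
  forall i j, A i -> A j.
Proof.
move=> irrP closedA i j Ai; have /connectP[p] := irrP i j.
elim: p i Ai => [i Ai _ -> //|k p IHp i Ai /= /andP[Pik pathp]].
exact: IHp (closedA _ _ Ai Pik) pathp.
Qed.

(** The maximum principle: at a maximum, a harmonic function equals an average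
of values that are no larger, so it takes its maximum at all successors too. *)
Lemma harmonic_constant (R : realType) (X : finType) (P : X -> X -> R)
    (h : X -> R) :
  is_transition_matrix P -> irreducible P ->
  (forall i, \sum_j P i j * h j = h i) -> forall i j, h i = h j.
Proof.
move=> tmP irrP harm i1 i2.
case: (@arg_maxP _ R X i1 xpredT h isT) => m _ max_m.
suff const i : h i = h m by rewrite !const.
apply/eqP; apply: (@irreducible_closed R X P (fun k => h k == h m) irrP _ m);
  last exact: eqxx.
move=> {}i j /eqP hi Pij.
have gap_ge0 k : true -> 0 <= P i k * (h m - h k).
  by move=> _; rewrite mulr_ge0 ?subr_ge0 ?(tmP i).1 //; apply: max_m.
have gap_sum : \sum_k P i k * (h m - h k) = 0.
  under eq_bigr do rewrite mulrBr.
  by rewrite sumrB harm -mulr_suml (tmP i).2 mul1r hi subrr.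
have /(_ j isT)/eqP := psumr_eq0P gap_ge0 gap_sum.
by rewrite mulf_eq0 gt_eqF //= subr_eq0 eq_sym.
Qed.

Lemma stationary_gt0 (R : realType) (X : finType) (P : X -> X -> R)
    (pi : {ffun X -> R}) :
  is_transition_matrix P -> irreducible P -> is_stationary P pi ->
  forall i, 0 < pi i.
Proof.
move=> tmP irrP [[pi_ge0 pi_sum] pi_inv] i.
have [i0 pi_i0 | pi0] := pickP (fun i => 0 < pi i); last first.
  have /eqP := pi_sum; rewrite big1 ?(eq_sym 0) ?oner_eq0 // => k _.
  by apply/eqP; rewrite eq_le pi_ge0 andbT leNgt pi0.
apply: (@irreducible_closed R X P (fun k => 0 < pi k) irrP _ i0) => //.
move=> k j pik Pkj; rewrite -(pi_inv j) (bigD1 k) //=.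
rewrite ltr_pwDl ?mulr_gt0 ?sumr_ge0 // => l _.
by rewrite mulr_ge0 ?(tmP l).1.
Qed.

(** Detailed balance turns the invariance of a measure [w] into the harmonicity
of its density [w i / pi i], which is therefore constant. *)
Lemma invariant_measure_prop (R : realType) (X : finType) (P : X -> X -> R)
    (pi : {ffun X -> R}) (w : X -> R) :
  is_transition_matrix P -> irreducible P -> is_stationary P pi ->
  (forall i j, pi i * P i j = pi j * P j i) ->
  (forall j, \sum_i w i * P i j = w j) ->
  exists c, forall i, w i = c * pi i.
Proof.
move=> tmP irrP stP balance w_inv.
have pi_neq0 i : pi i != 0 by rewrite gt_eqF // (stationary_gt0 tmP).
have harm j : \sum_i P j i * (w i / pi i) = w j / pi j.
  apply: (mulfI (pi_neq0 j)).
  rewrite mulrCA mulfV // mulr1 -[RHS]w_inv mulr_sumr; apply: eq_bigr => i _.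
  by rewrite !mulrA -balance -[_ * w i]mulrA [pi i * _]mulrC mulfK // mulrC.
have [i0 _ | X0] := pickP (@predT X); last first.
  by exists 0 => i; have := X0 i.
exists (w i0 / pi i0) => i.
by rewrite (harmonic_constant tmP irrP harm i0 i) divfK.
Qed.

(** * Slowing a chain down *)

(** The mass that the slowed chain [Q] holds back at a state stays there, so it
cancels from the invariance equation; what remains says that the mass
[pi i * tau i] that does move is invariant under [P]. *)
Lemma slowed_stationary_flow (R : realType) (X : finType) (P Q : X -> X -> R)
    (tau : X -> R) (pi : {ffun X -> R}) :
  (forall i j, Q i j = tau i * P i j + (1 - tau i) * (i == j)%:R) ->
  is_stationary Q pi ->
  forall j, \sum_i (pi i * tau i) * P i j = pi j * tau j.
Proof.
move=> QE [_ pi_inv] j; have := pi_inv j.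
under eq_bigr do rewrite QE mulrDr mulrA.
rewrite big_split /= [X in _ + X](bigD1 j) //= eqxx mulr1.
rewrite [X in _ + (_ + X)]big1 => [|i /negbTE ->]; last by rewrite !mulr0.
by rewrite addr0 mulrBr mulr1 => /(canRL (addrK _)) ->; rewrite opprB addrC subrK.
Qed.

Lemma mixr_gt0 (R : realType) (X U : finType) (rho mu : X -> U -> R) :
  (forall i u, 0 < rho i u) -> is_strategy mu -> forall i, 0 < mixr rho mu i.
Proof.
move=> rho_gt0 mu_str i; have [mu_ge0 mu_sum] := mu_str i.
have term_ge0 u : true -> 0 <= rho i u * mu i u.
  by move=> _; rewrite mulr_ge0 // ltW.
rewrite lt_neqAle sumr_ge0 // andbT eq_sym.
apply/eqP => /(psumr_eq0P term_ge0) mu0.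
have /eqP := mu_sum; rewrite big1 ?(eq_sym 0) ?oner_eq0 // => u _.
by have /eqP := mu0 u isT; rewrite mulf_eq0 gt_eqF //= => /eqP.
Qed.

(** With a zero diagonal of [P0], the holding probability [1 - rho i u] is
entirely due to the slowing down, and the speeds average linearly over
actions. *)
Lemma mixP_slowed (R : realType) (X U : finType) (P : U -> X -> X -> R)
    (P0 : X -> X -> R) (rho mu : X -> U -> R) :
  (forall i, P0 i i = 0) ->
  (forall u i j, j != i -> P u i j = rho i u * P0 i j) ->
  (forall u i, P u i i = 1 - rho i u) -> is_strategy mu ->
  forall i j, mixP P mu i j =
    mixr rho mu i * P0 i j + (1 - mixr rho mu i) * (i == j)%:R.
Proof.
move=> P0d Poff Pdiag mu_str i j; rewrite /mixP /mixr.
have [<-|ij] := eqVneq i j.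
  rewrite P0d mulr0 add0r mulr1 -[in RHS](mu_str i).2 -sumrB.
  by apply: eq_bigr => u _; rewrite Pdiag mulrBl mul1r.
rewrite mulr0 addr0 mulr_suml; apply: eq_bigr => u _.
by rewrite Poff 1?eq_sym // mulrAC.
Qed.

(** * Deterministic strategies *)

Lemma det_strategy (R : realType) (X U : finType) (d : {ffun X -> U}) :
  is_strategy (det R d).
Proof.
move=> i; split=> [u|]; first exact: ler0n.
rewrite (bigD1 (d i)) //= /det eqxx big1 ?addr0 // => u /negbTE.
by rewrite /det => ->.
Qed.

Lemma mixr_det (R : realType) (X U : finType) (r : X -> U -> R)
    (d : {ffun X -> U}) i :
  mixr r (det R d) i = r i (d i).
Proof.
rewrite /mixr (bigD1 (d i)) //= /det eqxx mulr1 big1 ?addr0 // => u /negbTE.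
by rewrite /det => ->; rewrite mulr0.
Qed.

(** * The average reward relative to a level *)

(** The constant is the normalization of [pi0 i / mixr rho mu i] to a
probability; it does not depend on the level [b]. *)
Lemma beta_excess (R : realType) (X U : finType) (P : U -> X -> X -> R)
    (r : X -> U -> R) (P0 : X -> X -> R) (pi0 : {ffun X -> R})
    (rho mu : X -> U -> R) :
  is_transition_matrix P0 -> irreducible P0 -> is_stationary P0 pi0 ->
  (forall i j, pi0 i * P0 i j = pi0 j * P0 j i) ->
  (forall i, P0 i i = 0) ->
  (forall i u, 0 < rho i u) ->
  (forall u i j, j != i -> P u i j = rho i u * P0 i j) ->
  (forall u i, P u i i = 1 - rho i u) ->
  is_strategy mu -> reversible (mixP P mu) ->
  exists2 c, 0 < c & forall b, beta P r mu - b =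
    c * \sum_i pi0 i * ((mixr r mu i - b) / mixr rho mu i).
Proof.
move=> tmP0 irrP0 st0 balance P0d rho_gt0 Poff Pdiag mu_str [pi' st' _].
have st : is_stationary (mixP P mu) (stationary (mixP P mu)).
  exact: (@xgetPex _ 0 (is_stationary (mixP P mu)) (ex_intro _ pi' st')).
move: st; rewrite /beta; move: (stationary _) => pi st.
have pi0_gt0 := stationary_gt0 tmP0 irrP0 st0.
have tau_gt0 := mixr_gt0 rho_gt0 mu_str.
have flow := slowed_stationary_flow (mixP_slowed P0d Poff Pdiag mu_str) st.
have [c piE] := invariant_measure_prop tmP0 irrP0 st0 balance flow.
have {}piE i : pi i = c * pi0 i / mixr rho mu i.
  by rewrite -piE mulfK ?gt_eqF.
have [[pi_ge0 pi_sum] _] := st.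
have [i _ pi_i] : exists2 i, true & 0 < pi i.
  have [i pi_i | pi_le0] := pickP (fun i => 0 < pi i); first by exists i.
  have /eqP := pi_sum; rewrite big1 ?(eq_sym 0) ?oner_eq0 // => i _.
  by apply/eqP; rewrite eq_le pi_ge0 andbT leNgt pi_le0.
exists c => [|b].
  by move: pi_i; rewrite piE -mulrA pmulr_lgt0 // divr_gt0.
rewrite -[b in LHS]mul1r -pi_sum mulr_suml -sumrB mulr_sumr.
by apply: eq_bigr => k _; rewrite -mulrBr piE -!mulrA [_^-1 * _]mulrC.
Qed.

(** * The iteration *)

Lemma improvement_stepP (R : realType) (X U : finType)
    (P : U -> X -> X -> R) (r rho : X -> U -> R) (d d' : {ffun X -> U}) :
  let q := improvement_ratio r rho (beta P r (det R d)) in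
  improvement_step P r rho d d' <->
  exists i v, [/\ q i (d i) < q i v, forall w, q i w <= q i v
                & d' = [ffun j => if j == i then v else d j]].
Proof.
move=> q; split=> [[i []]|[i [v [lt_q max_v ->]]]]; rewrite -/q.
  move=> lt_m [v qv ->]; exists i, v; split=> //; first by rewrite qv.
  by move=> w; rewrite qv; apply: le_bigmax.
have mE : q i v = \big[Num.max/q i (d i)]_(w : U) q i w.
  by apply/le_anti; rewrite le_bigmax bigmax_le // ltW.
by exists i; split; [rewrite -/q -mE | exists v].
Qed.

Lemma stuck_ratio_le (R : realType) (X U : finType)
    (P : U -> X -> X -> R) (r rho : X -> U -> R) (d : {ffun X -> U}) :
  ~ (exists d', improvement_step P r rho d d') ->
  let q := improvement_ratio r rho (beta P r (det R d)) in
  forall i v, q i v <= q i (d i).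
Proof.
move=> stuck q i v; rewrite leNgt; apply/negP => lt_q; apply: stuck.
case: (@arg_maxP _ R U v xpredT (q i) isT) => m _ max_m.
exists [ffun j => if j == i then m else d j]; apply/improvement_stepP.
by exists i, m; split=> // [|w]; [apply: lt_le_trans lt_q _|]; apply: max_m.
Qed.

Lemma no_infinite_ascent (R : realType) (T : finType) (f : T -> R)
    (x : nat -> T) :
  ~ (forall k, f (x k) < f (x k.+1)).
Proof.
move=> /(homo_ltn lt_trans) incr.
have inj : injective (fun k : 'I_#|T|.+1 => x k).
  move=> k l xkl; apply/val_inj; case: (ltngtP k l) => // /incr;
  by rewrite xkl ltxx.
by have := leq_card _ inj; rewrite card_ord ltnn.
Qed.

Lemma policy_iteration_stops (R : realType) (X U : finType)
    (P : U -> X -> X -> R) (r rho : X -> U -> R)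
    (s : nat -> option {ffun X -> U}) :
  (forall d d', improvement_step P r rho d d' ->
     beta P r (det R d) < beta P r (det R d')) ->
  is_policy_iteration P r rho s ->
  exists K d, [/\ s K = Some d, s K.+1 = None
                & ~ exists d', improvement_step P r rho d d'].
Proof.
move=> incr [s0 s_step].
have [k0 sk0] : exists k, s k == None.
  apply: contrapT => s_some.
  have {}s_some k : exists d, s k == Some d.
    by case sk: (s k) => [d|]; [exists d | case: s_some; exists k; apply/eqP].
  pose x k := xchoose (s_some k).
  have xP k : s k = Some (x k) by apply/eqP/(xchooseP (s_some k)).
  apply: (@no_infinite_ascent R _ (fun d => beta P r (det R d)) x) => k.
  by apply: incr; have := s_step k; rewrite !xP.
case: (ex_minnP (ex_intro (fun k => s k == None) k0 sk0)) => -[/eqP //|K].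
move=> /eqP sK1 minK; exists K.
case sK: (s K) => [d|]; last by have := minK K; rewrite sK ltnn => /(_ isT).
by exists d; split=> //; have := s_step K; rewrite sK sK1.
Qed.

(** Only the term of the modified state changes in the sum of [beta_excess], and
it grows. *)
Lemma improvement_step_lt (R : realType) (X U : finType)
    (P : U -> X -> X -> R) (r : X -> U -> R) (rho : X -> U -> R)
    (w : X -> R) (d d' : {ffun X -> U}) :
  (forall i, 0 < w i) ->
  (forall mu, is_strategy mu -> exists2 c, 0 < c & forall b, beta P r mu - b =
    c * \sum_i w i * ((mixr r mu i - b) / mixr rho mu i)) ->
  improvement_step P r rho d d' ->
  beta P r (det R d) < beta P r (det R d').
Proof.
move=> w_gt0 excess /improvement_stepP[i [v [lt_q _ ->]]].
set b := beta P r (det R d) in lt_q *; set d1 := finfun _.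
have [c c_gt0 /(_ b)] := excess _ (@det_strategy R X U d).
rewrite subrr => /esym/eqP; rewrite mulf_eq0 gt_eqF //= => /eqP sum0.
have [c' c'_gt0 /(_ b) bE] := excess _ (@det_strategy R X U d1).
rewrite -subr_gt0 bE mulr_gt0 // -[ltLHS]sum0 (bigD1 i) //= [ltRHS](bigD1 i) //=.
rewrite !mixr_det ltr_leD //; first by rewrite ltr_pM2l // ffunE eqxx.
by apply: ler_sum => j /negbTE ji; rewrite !mixr_det ffunE ji.
Qed.

Lemma no_improvement_optimal (R : realType) (X U : finType)
    (P : U -> X -> X -> R) (r : X -> U -> R) (rho : X -> U -> R)
    (w : X -> R) (d : {ffun X -> U}) :
  (forall i, 0 < w i) -> (forall i u, 0 < rho i u) ->
  (forall mu, is_strategy mu -> exists2 c, 0 < c & forall b, beta P r mu - b =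
    c * \sum_i w i * ((mixr r mu i - b) / mixr rho mu i)) ->
  ~ (exists d', improvement_step P r rho d d') ->
  optimal P r (det R d).
Proof.
move=> w_gt0 rho_gt0 excess /stuck_ratio_le.
set b := beta P r (det R d) => max_q.
split=> [|mu mu_str]; first exact: det_strategy.
have [c c_gt0 /(_ b)] := excess _ (@det_strategy R X U d).
rewrite subrr => /esym/eqP; rewrite mulf_eq0 gt_eqF //= => /eqP sum0.
have [c' c'_gt0 /(_ b) bE] := excess _ mu_str.
rewrite -/b -subr_le0 bE pmulr_rle0 // -[leRHS]sum0 ler_sum // => i _.
rewrite ler_pM2l // !mixr_det ler_pdivrMr ?mixr_gt0 // /mixr.
(* [mixr r mu i - b] is the sum of the ratios at [i] with weights
   [rho i u * mu i u], whose total is [mixr rho mu i]. *)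
rewrite -[b in leLHS]mul1r -(mu_str i).2 mulr_suml -sumrB mulr_sumr.
apply: ler_sum => u _; rewrite [mu i u * b]mulrC -mulrBl mulrA.
rewrite ler_wpM2r ?(mu_str i).1 // -ler_pdivrMr //; exact: max_q.
Qed.

Theorem theorem3 (R : realType) (X U : finType)
    (hX : (2 <= #|X|)%N) (hU : (2 <= #|U|)%N)
    (P : U -> X -> X -> R) (r : X -> U -> R)
    (hP : is_rmdp P)
    (E : rel X) (hE : is_canonical_graph P E) (hbi : biconnected E)
    (P0 : X -> X -> R)
    (hP0 : is_transition_matrix P0)
    (hP0irr : irreducible P0) (hP0rev : reversible P0)
    (hP0E : forall i j, 0 < P0 i j <-> E i j)
    (rho : X -> U -> R)
    (hrho : forall i u, 0 < rho i u <= 1)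
    (hPoff : forall u i j, j != i -> P u i j = rho i u * P0 i j)
    (hPdiag : forall u i, P u i i = 1 - rho i u)
    (s : nat -> option {ffun X -> U})
    (hs : is_policy_iteration P r rho s) :
  (forall k d d', s k = Some d -> s k.+1 = Some d' ->
     beta P r (det R d) < beta P r (det R d')) /\
  (exists K d, [/\ s K = Some d, s K.+1 = None & optimal P r (det R d)]).
Proof.
have [pi0 st0 balance] := hP0rev.
have P0d i : P0 i i = 0.
  have [_ irrE _ _] := hE; apply/eqP; rewrite eq_le (hP0 i).1 andbT leNgt.
  by apply/negP => /hP0E; rewrite irrE.
have rho_gt0 i u : 0 < rho i u by case/andP: (hrho i u).
have pi0_gt0 := stationary_gt0 hP0 hP0irr st0.
have excess mu (mu_str : is_strategy mu) :=
  beta_excess r hP0 hP0irr st0 balance P0d rho_gt0 hPoff hPdiag mu_str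
    (hP.2 mu mu_str).2.
have step_lt d d' := improvement_step_lt pi0_gt0 excess (d := d) (d' := d').
split=> [k d d' sk sk1|].
  by apply: step_lt; have := hs.2 k; rewrite sk sk1.
have [K [d [sK sK1 stuck]]] := policy_iteration_stops step_lt hs.
by exists K, d; split=> //; apply: (no_improvement_optimal pi0_gt0 rho_gt0).
Qed.
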